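(* For each $n\ge 1$ let $\mathcal{Q}_n:=\mathbb{K}[x_1,\dots,x_n]$, let $\mathrm{id}:=1\in\mathbb{K}[x_1]$, and for $P\in\mathcal{Q}_n$, $Q\in\mathcal{Q}_m$, $1\le i\le n$, define $$(P\circ_i Q)(x_1,\dots,x_{n+m-1}):=P(x_1,\dots,x_{i-1},\,x_i+\cdots+x_{i+m-1},\,x_{i+m},\dots,x_{n+m-1})\,Q(x_i,\dots,x_{i+m-1}).$$ Then $(\mathcal{Q}_n)_{n\ge1}$ with these partial compositions is a ns operad, and there is an isomorphism of ns operads $AsDer\cong\mathcal{Q}$ sending $\mathrm{id}\mapsto 1\in\mathbb{K}[x_1]$, $D\mapsto x_1\in\mathbb{K}[x_1]$ and $\mu\mapsto 1\in\mathbb{K}[x_1,x_2]$. Equivalently, the full composition is $$\gamma(P;Q_1,\dots,Q_k)(x_1,\dots,x_n)=P(x_1+\cdots+x_{i_1},\,x_{i_1+1}+\cdots+x_{i_1+i_2},\dots)\,Q_1(x_1,\dots,x_{i_1})\,Q_2(x_{i_1+1},\dots,x_{i_1+i_2})\cdots$$ for $P\in\mathcal{Q}_k$, $Q_r\in\mathcal{Q}_{i_r}$, $n=i_1+\cdots+i_k$. Under this isomorphism the $n$-ary operation $(a_1,\dots,a_n)\mapsto D^{j_1}(a_1)D^{j_2}(a_2)\cdots D^{j_n}(a_n)$ (i.e. $\mu_n\circ(D^{j_1},\dots,D^{j_n})$) corresponds to the monomial $x_1^{j_1}x_2^{j_2}\cdots x_n^{j_n}$; in particular $AsDer_n\cong\mathbb{K}[x_1,\dots,x_n]$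 as vector spaces.
   Context: $\mathbb{K}$ is a commutative unital ring (think of a field). A nonsymmetric (ns) operad is a family of vector spaces $(\mathcal{P}_n)_{n\ge1}$ with an element $\mathrm{id}\in\mathcal{P}_1$ and linear partial compositions $\circ_i:\mathcal{P}_m\otimes\mathcal{P}_n\to\mathcal{P}_{m+n-1}$ ($1\le i\le m$) such that $\mathrm{id}$ is a two-sided unit and (I) $(\lambda\circ_i\mu)\circ_{i-1+j}\nu=\lambda\circ_i(\mu\circ_j\nu)$ for $\lambda\in\mathcal{P}_l,\mu\in\mathcal{P}_m$, $1\le i\le l$, $1\le j\le m$; (II) $(\lambda\circ_i\mu)\circ_{k+m-1}\nu=(\lambda\circ_k\nu)\circ_i\mu$ for $1\le i<k\le l$. $AsDer$ denotes the ns operad generated by a unary operation $D$ and a binary operation $\mu$ subject to the relations $\mu\circ_1\mu=\mu\circ_2\mu$ (associativity) and $D\circ_1\mu=\mu\circ_1 D+\mu\circ_2 D$ (Leibniz rule); its algebras are (nonunital) associative algebras $A$ equipped with a derivation $D^A$, i.e. a linear map with $D^A(ab)=D^A(a)b+aD^A(b)$. $\mu_n$ denotes the $n$-ary operation obtained by composing $n-1$ copies of $\mu$ ($\mu_1=\mathrm{id}$). *)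

(* Defs.v *)
From HB Require Import structures.
From mathcomp Require Import all_boot all_order all_algebra.

Set Implicit Arguments.
Unset Strict Implicit.
Unset Printing Implicit Defensive.

Import Order.TTheory GRing.Theory Num.Theory.
Local Open Scope ring_scope.

(* In mpolyR K n.+1 the outermost indeterminate 'X is the LAST        *)
(* variable x_{n+1}; variables are indexed 0-based: mvar N a = x_{a+1}.*)

Fixpoint mpolyR (K : comNzRingType) (n : nat) : comNzRingType :=
  match n with
  | 0 => K
  | n'.+1 => ({poly mpolyR K n'} : comNzRingType)
  end.

Fixpoint mconst (K : comNzRingType) (n : nat) : K -> mpolyR K n :=
  match n return K -> mpolyR K n with
  | 0 => fun c => c
  | n'.+1 => fun c => ((@mconst K n' c)%:P : {poly mpolyR K n'})
  end.

(* the variable x_{a+1} in n variables (0 if a >= n) *)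
Fixpoint mvar (K : comNzRingType) (n : nat) (a : nat) : mpolyR K n :=
  match n return mpolyR K n with
  | 0 => 0
  | n'.+1 => (if a == n' then 'X else (mvar K n' a)%:P : {poly mpolyR K n'})
  end.

Fixpoint meval (K : comNzRingType) (N n : nat) :
    mpolyR K n -> (nat -> mpolyR K N) -> mpolyR K N :=
  match n return mpolyR K n -> (nat -> mpolyR K N) -> mpolyR K N with
  | 0 => fun c _ => mconst N c
  | n'.+1 => fun p v =>
      \sum_(i < size (p : {poly mpolyR K n'}))
         @meval K N n' ((p : {poly mpolyR K n'})`_i) v * v n' ^+ i
  end.

Lemma mconstM (K : comNzRingType) n (a b : K) :
  mconst n (a * b) = mconst n a * mconst n b.
Proof. by elim: n => //= n IH; rewrite IH polyCM. Qed.

Lemma mconstD (K : comNzRingType) n (a b : K) :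
  mconst n (a + b) = mconst n a + mconst n b.
Proof. by elim: n => //= n IH; rewrite IH polyCD. Qed.

Lemma mconst1 (K : comNzRingType) n : mconst n (1 : K) = 1.
Proof. by elim: n => //= n IH; rewrite IH. Qed.

Definition mpoly (K : comNzRingType) (n : nat) : Type := mpolyR K n.

HB.instance Definition _ (K : comNzRingType) (n : nat) :=
  GRing.ComNzRing.on (mpoly K n).

Definition mscale (K : comNzRingType) (n : nat) (c : K) (p : mpoly K n) :
  mpoly K n := mconst n c * p.

Lemma mscaleA (K : comNzRingType) n (a b : K) (v : mpoly K n) :
  mscale a (mscale b v) = mscale (a * b) v.
Proof. by rewrite /mscale mconstM mulrA. Qed.

Lemma mscale1 (K : comNzRingType) n : left_id (1 : K) (@mscale K n).
Proof. by move=> v; rewrite /mscale mconst1 mul1r. Qed.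

Lemma mscaleDr (K : comNzRingType) n :
  right_distributive (@mscale K n) +%R.
Proof. by move=> a u v; rewrite /mscale mulrDr. Qed.

Lemma mscaleDl (K : comNzRingType) n (v : mpoly K n) :
  {morph (@mscale K n)^~ v : a b / a + b}.
Proof. by move=> a b; rewrite /mscale mconstD mulrDl. Qed.

HB.instance Definition _ (K : comNzRingType) (n : nat) :=
  GRing.Zmodule_isLmodule.Build K (mpoly K n)
    (@mscaleA K n) (@mscale1 K n) (@mscaleDr K n) (@mscaleDl K n).

(* Nonsymmetric operads.  Arities are SHIFTED: P k is the space of     *)
(* operations of arity k.+1 (so all arities n >= 1 are covered).      *)
(* comp m n i x y is x o_i y (i is 1-based, 1 <= i <= m.+1), landing  *)
(* in arity (m.+1)+(n.+1)-1 = (m+n).+1.                                *)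
(* Equalities between elements of possibly non-convertible index types *)
(* are stated as equalities of dependent pairs in {k & P k}.           *)

Definition opTag (K : comNzRingType) (P : nat -> lmodType K) (k : nat) (x : P k)
  : {k : nat & P k} := existT (fun k => P k : Type) k x.

Definition comp_type (K : comNzRingType) (P : nat -> lmodType K) :=
  forall m n : nat, nat -> P m -> P n -> P (m + n)%N.

Definition ns_operad (K : comNzRingType) (P : nat -> lmodType K) (id : P 0%N)
    (comp : comp_type P) : Prop :=
  [/\
      ((forall m n i, (1 <= i <= m.+1)%N ->
         forall (a : K) (x y : P m) (z : P n),
         comp m n i (a *: x + y) z = a *: comp m n i x z + comp m n i y z)
      /\ (forall m n i, (1 <= i <= m.+1)%N ->
         forall (a : K) (x : P m) (y z : P n),
         comp m n i x (a *: y + z) = a *: comp m n i x y + comp m n i x z)),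
      (forall n (x : P n), opTag (comp 0%N n 1%N id x) = opTag x),
      (forall n i (x : P n), (1 <= i <= n.+1)%N -> opTag (comp n 0%N i x id) = opTag x),
      (forall l m n (x : P l) (y : P m) (z : P n) i j,
         (1 <= i <= l.+1)%N -> (1 <= j <= m.+1)%N ->
         opTag (comp (l + m)%N n (i - 1 + j)%N (comp l m i x y) z)
         = opTag (comp l (m + n)%N i x (comp m n j y z))) &
      (forall l m n (x : P l) (y : P m) (z : P n) i k,
         (1 <= i)%N -> (i < k)%N -> (k <= l.+1)%N ->
         opTag (comp (l + m)%N n (k + m)%N (comp l m i x y) z)
         = opTag (comp (l + n)%N m i (comp l n k x z) y))].

Definition operad_morphism (K : comNzRingType)
    (P : nat -> lmodType K) (idP : P 0%N) (compP : comp_type P)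
    (O : nat -> lmodType K) (idO : O 0%N) (compO : comp_type O)
    (f : forall k, P k -> O k) : Prop :=
  [/\ (forall k (a : K) (x y : P k), f k (a *: x + y) = a *: f k x + f k y),
      f 0%N idP = idO &
      (forall m n i (x : P m) (y : P n), (1 <= i <= m.+1)%N ->
         f (m + n)%N (compP m n i x y) = compO m n i (f m x) (f n y))].

Definition asder_rel (K : comNzRingType) (P : nat -> lmodType K)
    (comp : comp_type P) (d : P 0%N) (mu : P 1%N) : Prop :=
  comp 1%N 1%N 1%N mu mu = comp 1%N 1%N 2%N mu mu /\
  (comp 0%N 1%N 1%N d mu : P 1%N)
    = (comp 1%N 0%N 1%N mu d : P 1%N) + (comp 1%N 0%N 2%N mu d : P 1%N).

(* (P, id, comp) together with d (image of D) and mu (image of mu) is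
   the ns operad AsDer = free ns operad on D, mu modulo the relations:
   the relations hold, and it is initial among ns operads with such a
   pair of elements (universal property of the presented operad).
   Equivalently: the unique operad morphism AsDer -> P with
   D |-> d, mu |-> mu is an isomorphism. *)
Definition presents_AsDer (K : comNzRingType) (P : nat -> lmodType K)
    (idP : P 0%N) (compP : comp_type P) (d : P 0%N) (mu : P 1%N) : Prop :=
  asder_rel compP d mu /\
  forall (O : nat -> lmodType K) (idO : O 0%N) (compO : comp_type O),
    ns_operad idO compO ->
    forall (d' : O 0%N) (mu' : O 1%N), asder_rel compO d' mu' ->
    exists f : forall k, P k -> O k,
      [/\ operad_morphism idP compP idO compO f, f 0%N d = d', f 1%N mu = mu' &
          forall g : forall k, P k -> O k,
            operad_morphism idP compP idO compO g -> g 0%N d = d' -> g 1%N mu = mu' ->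
            forall k x, g k x = f k x].

Fixpoint op_mun (K : comNzRingType) (P : nat -> lmodType K) (id : P 0%N)
    (comp : comp_type P) (mu : P 1%N) (k : nat) : P k :=
  match k return P k with
  | 0 => id
  | k'.+1 => comp 1%N k' 1%N mu (op_mun id comp mu k')
  end.

Fixpoint op_Dpow (K : comNzRingType) (P : nat -> lmodType K) (id : P 0%N)
    (comp : comp_type P) (d : P 0%N) (j : nat) : P 0%N :=
  match j with
  | 0 => id
  | j'.+1 => comp 0%N 0%N 1%N d (op_Dpow id comp d j')
  end.

Definition castP (K : comNzRingType) (P : nat -> lmodType K) m n (e : m = n)
  (x : P m) : P n := eq_rect m (fun k => P k : Type) x n e.

(* x o (f_0, ..., f_{r-1}, id, ..., id) for unary f's:
   successively compose f_s at position s.+1, for s < r *)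
Fixpoint op_fill_unary (K : comNzRingType) (P : nat -> lmodType K)
    (comp : comp_type P) (k : nat) (x : P k) (fs : nat -> P 0%N) (r : nat) : P k :=
  match r with
  | 0 => x
  | r'.+1 => castP (addn0 k) (comp k 0%N r'.+1 (op_fill_unary comp x fs r') (fs r'))
  end.

(* full composition gamma(x; y_1, ..., y_r) via partial compositions:
   plug y_1 at position 1, then y_2 just after the block of y_1, etc. *)
Fixpoint op_gamma_from (K : comNzRingType) (P : nat -> lmodType K)
    (comp : comp_type P) (pos : nat) (x : {k : nat & P k})
    (ys : seq {k : nat & P k}) : {k : nat & P k} :=
  match ys with
  | [::] => x
  | y :: ys' =>
      op_gamma_from comp (pos + (tag y).+1)%N
        (opTag (comp (tag x) (tag y) pos (tagged x) (tagged y))) ys'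
  end.

Definition op_gamma (K : comNzRingType) (P : nat -> lmodType K)
    (comp : comp_type P) (x : {k : nat & P k}) (ys : seq {k : nat & P k}) :=
  op_gamma_from comp 1%N x ys.

Definition Q (K : comNzRingType) (k : nat) : lmodType K := mpoly K k.+1.

Definition Qid (K : comNzRingType) : Q K 0%N := (1 : mpoly K 1).

(* (P o_i R)(x_1..x_{N}) = P(x_1,..,x_{i-1}, x_i+..+x_{i+n}, x_{i+n+1},..)
                           * R(x_i, ..., x_{i+n})
   for P in m.+1 variables, R in n.+1 variables, N = m+n+1 (0-based below) *)
Definition Qcomp (K : comNzRingType) : comp_type (Q K) :=
  fun m n i (p : Q K m) (r : Q K n) =>
    let N := (m + n).+1 in
    ((@meval K N _ (p : mpolyR K m.+1)
        (fun a => if (a < i.-1)%N then mvar K N a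
                  else if a == i.-1 then \sum_(b < n.+1) mvar K N (i.-1 + b)
                  else mvar K N (a + n)))
     * @meval K N _ (r : mpolyR K n.+1) (fun b => mvar K N (i.-1 + b)) : mpoly K N).

Definition QD (K : comNzRingType) : Q K 0%N := (mvar K 1 0 : mpoly K 1).
Definition Qmu (K : comNzRingType) : Q K 1%N := (1 : mpoly K 2).

Definition Qgamma_formula (K : comNzRingType) (k : nat) (p : Q K k)
    (ys : seq {n : nat & Q K n}) : Q K (\sum_(r < k.+1) (tag (nth (opTag (0 : Q K 0%N)) ys r)).+1).-1 :=
  let y r := nth (opTag (0 : Q K 0%N)) ys r in
  let ar r := (tag (y r)).+1 in
  let off r := (\sum_(s < r) ar s)%N in
  let M := (\sum_(r < k.+1) ar r).-1.+1 in
  ((@meval K M _ (p : mpolyR K k.+1) (fun r => \sum_(b < ar r) mvar K M (off r + b)))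
   * \prod_(r < k.+1)
        @meval K M _ (tagged (y r) : mpolyR K (tag (y r)).+1) (fun b => mvar K M (off r + b))
   : mpoly K M).

(* Main.v *)
(** AsDer is spanned by the operations mu_n o (D^{j_1}, ..., D^{j_n}).  In [Q],
    composing on the right with D in position j is multiplication by x_j, and
    composing the constant polynomials 1 with mu gives 1 again, so [Q] is
    generated from its unit by right compositions with D and mu.  For an operad
    O with elements d, mu satisfying the relations, the operators _ o_j d on O_n
    commute, so K[x_1, ..., x_n] acts on O_n, and P |-> P . mu_n is the only
    candidate for a morphism Q -> O.  It commutes with right composition by D by
    construction, and by mu because of the Leibniz rule; compatibility with an
    arbitrary P o_i R then follows by generating R, using sequential
    associativity. *)

Require Import Defs.
From HB Require Import structures.
From mathcomp Require Import all_boot all_order all_algebra.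
From mathcomp Require Import zify.
Import GRing.Theory.
Local Open Scope ring_scope.

Set Implicit Arguments.
Unset Strict Implicit.
Unset Printing Implicit Defensive.

(** * Evaluation of iterated polynomials as ring morphisms *)

Section Substitution.
Variable K : comNzRingType.

Lemma mconst_rmorphism n :
  exists f : {rmorphism K -> mpolyR K n}, f =1 mconst n.
Proof.
elim: n => [|n [f fE]]; first by exists idfun.
exists ((polyC : {rmorphism _ -> {poly mpolyR K n}}) \o f : {rmorphism _ -> _}).
by move=> c /=; rewrite fE.
Qed.

(** Each stage maps the previous evaluation over the coefficients and then evaluates the last
    variable at [v n]; both are ring morphisms. The existential form transfers the morphism lemmas
    to the recursive function by rewriting. *)
Lemma meval_rmorphism N n (v : nat -> mpolyR K N) :
  exists f : {rmorphism mpolyR K n -> mpolyR K N}, f =1 (@meval K N n)^~ v.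
Proof.
elim: n => [|n [f fE]]; first exact: mconst_rmorphism.
exists ((horner_eval (v n) : {rmorphism _ -> _}) \o
  (map_poly f : {rmorphism {poly mpolyR K n} -> _}) : {rmorphism _ -> _}).
move=> p /=; rewrite /horner_eval /map_poly horner_poly.
by apply: eq_bigr => i _; rewrite fE.
Qed.

Lemma meval1 N n (v : nat -> mpolyR K N) : @meval K N n 1 v = 1.
Proof. by have [f fE] := @meval_rmorphism N n v; rewrite -fE rmorph1. Qed.

Lemma mevalD N n (v : nat -> mpolyR K N) (p q : mpolyR K n) :
  meval (p + q) v = meval p v + meval q v.
Proof. by have [f fE] := @meval_rmorphism N n v; rewrite -!fE rmorphD. Qed.

Lemma mevalM N n (v : nat -> mpolyR K N) (p q : mpolyR K n) :
  meval (p * q) v = meval p v * meval q v.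
Proof. by have [f fE] := @meval_rmorphism N n v; rewrite -!fE rmorphM. Qed.

Lemma meval_sum N n (v : nat -> mpolyR K N) I r (P : pred I)
    (F : I -> mpolyR K n) :
  meval (\sum_(i <- r | P i) F i) v = \sum_(i <- r | P i) meval (F i) v.
Proof.
have [f fE] := @meval_rmorphism N n v; rewrite -!fE rmorph_sum.
by apply: eq_bigr => i _; rewrite fE.
Qed.

Lemma meval_prod N n (v : nat -> mpolyR K N) I r (P : pred I)
    (F : I -> mpolyR K n) :
  meval (\prod_(i <- r | P i) F i) v = \prod_(i <- r | P i) meval (F i) v.
Proof.
have [f fE] := @meval_rmorphism N n v; rewrite -!fE rmorph_prod.
by apply: eq_bigr => i _; rewrite fE.
Qed.

Lemma mevalX N n (v : nat -> mpolyR K N) (p : mpolyR K n) j :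
  meval (p ^+ j) v = meval p v ^+ j.
Proof. by have [f fE] := @meval_rmorphism N n v; rewrite -!fE rmorphXn. Qed.

Lemma meval_polyC N n (v : nat -> mpolyR K N) (c : mpolyR K n) :
  @meval K N n.+1 (c%:P) v = meval c v.
Proof.
have [f fE] := @meval_rmorphism N n v.
rewrite /= size_polyC; case: eqVneq => [->|_] /=.
  by rewrite big_ord0 -fE rmorph0.
by rewrite big_ord1 polyseqC; case: eqP => [->|] /=; rewrite expr0 mulr1.
Qed.

Lemma meval_mconst N n (v : nat -> mpolyR K N) c :
  meval (mconst n c) v = mconst N c.
Proof.
elim: n => [|n IH] //; rewrite [mconst _ _]/= meval_polyC; exact: IH.
Qed.

Lemma meval_mvar N n (v : nat -> mpolyR K N) a :
  (a < n)%N -> meval (mvar K n a) v = v a.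
Proof.
elim: n => // n IH lt_an; have [->|ne_an] := eqVneq a n; last first.
  by rewrite [mvar _ _ _]/= (negPf ne_an) meval_polyC IH // ltn_neqAle ne_an.
have [f fE] := @meval_rmorphism N n v.
rewrite [mvar _ _ _]/= eqxx [LHS]/= size_polyX !big_ord_recl big_ord0 /=.
by rewrite !coefX /= -!fE rmorph0 rmorph1 mul0r add0r mul1r addr0.
Qed.

(** The case of 0 is recovered as (-1) * 1 + 1. With one more variable, [poly_ind] handles the last
    variable and the induction hypothesis handles the constant coefficient. *)
Lemma mpoly_ind n (P : mpolyR K n -> Prop) :
  P 1 -> (forall c p q, P p -> P q -> P (mconst n c * p + q)) ->
  (forall a p, (a < n)%N -> P p -> P (p * mvar K n a)) ->
  forall p, P p.
Proof.
elim: n P => [|n IH] P P1 Plin Pvar.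
  have P0 : P 0 by have := Plin (-1) 1 1 P1 P1; rewrite /= mulr1 addNr.
  by move=> c; rewrite -[c]addr0 -[c]mulr1; apply: Plin.
have P0 : P 0.
  have [f fE] := mconst_rmorphism n.+1.
  by have := Plin (-1) 1 1 P1 P1; rewrite -fE rmorphN1 mulr1 addNr.
have PD p q : P p -> P q -> P (p + q).
  by move=> Pp Pq; have := Plin 1 p q Pp Pq; rewrite mconst1 mul1r.
apply: (@poly_ind (mpolyR K n)) => // p c Pp; apply: PD.
  by have := Pvar n p (ltnSn n) Pp; rewrite /= eqxx.
move: c; apply: IH => [|c p' q Pp' Pq|a p' lt_an Pp'].
- exact: P1.
- by rewrite polyCD polyCM; apply: (Plin c).
have := Pvar a _ (ltnW lt_an : (a < n.+1)%N) Pp'.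
by rewrite [mvar _ _ _]/= (ltn_eqF lt_an) polyCM.
Qed.

Lemma eq_meval N n (v w : nat -> mpolyR K N) (p : mpolyR K n) :
  (forall a, (a < n)%N -> v a = w a) -> meval p v = meval p w.
Proof.
move=> eq_vw; elim/mpoly_ind: p => [|c p q IHp IHq|a p lt_an IHp].
- by rewrite !meval1.
- by rewrite !mevalD !mevalM IHp IHq !meval_mconst.
- by rewrite !mevalM IHp !meval_mvar // eq_vw.
Qed.

Lemma meval_comp N M n (v : nat -> mpolyR K M) (w : nat -> mpolyR K N)
    (p : mpolyR K n) :
  meval (meval p v) w = meval p (fun a => meval (v a) w).
Proof.
elim/mpoly_ind: p => [|c p q IHp IHq|a p lt_an IHp].
- by rewrite !meval1.
- by rewrite !mevalD !mevalM IHp IHq !meval_mconst.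
- by rewrite !mevalM IHp !meval_mvar.
Qed.

Lemma meval_id n (p : mpolyR K n) : meval p (mvar K n) = p.
Proof.
elim/mpoly_ind: p => [|c p q IHp IHq|a p lt_an IHp].
- by rewrite !meval1.
- by rewrite !mevalD !mevalM IHp IHq !meval_mconst.
- by rewrite !mevalM IHp !meval_mvar.
Qed.

(** * Polynomials acting on a module through commuting operators *)

Section Action.
Variables (V : lmodType K) (E : nat -> V -> V) (v : V).

(* the value at [v] of [p] with the operator [E a] substituted for the
   variable of index [a], the operators of highest index applied last *)
Fixpoint mact n : mpolyR K n -> V :=
  match n return mpolyR K n -> V with
  | 0 => fun c => c *: v
  | n'.+1 => fun p => \sum_(i < size (p : {poly mpolyR K n'}))
       iter i (E n') (mact (p : {poly mpolyR K n'})`_i)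
  end.

(** Bounded because partial composition is linear only at existing inputs. *)
Definition lin_below n := forall j, (j < n)%N ->
  forall a x y, E j (a *: x + y) = a *: E j x + E j y.

Lemma lin_below0 n j : lin_below n -> (j < n)%N -> E j 0 = 0.
Proof.
by move=> /[apply] /(_ (-1) 0 0); rewrite scaler0 addr0 scaleN1r addNr.
Qed.

Lemma iter_lin n j i a x y : lin_below n -> (j < n)%N ->
  iter i (E j) (a *: x + y) = a *: iter i (E j) x + iter i (E j) y.
Proof. by move=> /[apply] linE; elim: i => //= i ->. Qed.

Lemma mact0 n : mact (0 : mpolyR K n) = 0.
Proof. by case: n => [|n] /=; rewrite ?scale0r // size_poly0 big_ord0. Qed.

(** A common bound allows polynomials of different sizes to be added termwise; the extra
    coefficients are 0, which linear operators preserve. *)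
Lemma mact_widen n (p : {poly mpolyR K n}) s : lin_below n.+1 ->
  (size p <= s)%N ->
  @mact n.+1 p = \sum_(i < s) iter i (E n) (mact p`_i).
Proof.
move=> linE les /=.
rewrite (big_ord_widen _ (fun i => iter i (E n) (mact p`_i)) les) big_mkcond.
apply: eq_bigr => i _; case: ltnP => // /(nth_default 0) ->.
by rewrite mact0; elim: (nat_of_ord i) => //= k <-; rewrite (lin_below0 linE).
Qed.

Lemma mact1 n : mact (1 : mpolyR K n) = v.
Proof.
elim: n => [|n IH] /=; first by rewrite scale1r.
by rewrite size_poly1 big_ord1 polyseq1.
Qed.

Lemma mact_linear n c (p q : mpolyR K n) : lin_below n ->
  mact (mconst n c * p + q) = c *: mact p + mact q.
Proof.
elim: n p q => [|n IH] p q linE; first by rewrite /= scalerDl scalerA.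
have linE' : lin_below n by move=> j /ltnW/linE.
pose s := maxn (size (p : {poly mpolyR K n})) (size (q : {poly mpolyR K n})).
have les : (size (((mconst n c)%:P * p + q)%R : {poly mpolyR K n}) <= s)%N.
  apply: leq_trans (size_polyD _ _) _; rewrite geq_max leq_maxr andbT.
  by rewrite mul_polyC; apply: leq_trans (size_scale_leq _ _) (leq_maxl _ _).
rewrite !(@mact_widen _ _ s) ?leq_maxl ?leq_maxr //.
rewrite scaler_sumr -big_split; apply: eq_bigr => i _ /=.
by rewrite coefD coefCM IH // (@iter_lin n.+1).
Qed.

(** The last variable shifts the coefficients, which adds one outermost operator. An earlier
    variable acts on the coefficients, and commutation moves [E j] out through the powers of the
    last operator. *)
Lemma mact_mvar n j (p : mpolyR K n) : lin_below n ->
  (forall i j x, (i < n)%N -> (j < n)%N -> E i (E j x) = E j (E i x)) ->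
  (j < n)%N -> mact (p * mvar K n j) = E j (mact p).
Proof.
elim: n p => // n IH p linE commE lt_jn.
have linE' : lin_below n by move=> i /ltnW/linE.
have Esum m (F : 'I_m -> V) : E j (\sum_(i < m) F i) = \sum_(i < m) E j (F i).
  apply: (big_morph (E j)) => [x y|]; last exact: lin_below0 lt_jn.
  by have := linE j lt_jn 1 x y; rewrite !scale1r.
rewrite [mvar _ _ _]/=; have [eq_jn|ne_jn] := eqVneq j n.
  rewrite (@mact_widen _ _ (size (p : {poly mpolyR K n})).+1) //; last first.
    by rewrite (leq_trans (size_polyMleq _ _)) // size_polyX addn2.
  rewrite big_ord_recl coefMX /= mact0 add0r Esum.
  by apply: eq_bigr => i _; rewrite /bump coefMX eq_jn.
have lt_jn' : (j < n)%N by rewrite ltn_neqAle ne_jn.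
rewrite (@mact_widen _ _ (size (p : {poly mpolyR K n}))) //; last first.
  rewrite (leq_trans (size_polyMleq _ _)) // size_polyC.
  by case: (_ != _); rewrite ?addn1 ?addn0 // leq_pred.
rewrite (@mact_widen n p (size (p : {poly mpolyR K n}))) // Esum.
apply: eq_bigr => i _; rewrite coefMC IH //; last first.
  by move=> ? ? ? /ltnW ? /ltnW ?; apply: commE.
by move: (mact _) => x; elim: (nat_of_ord i) => //= k ->; rewrite commE.
Qed.

End Action.
End Substitution.

(** * Partial compositions on operations bundled with their arity *)

Section TaggedComposition.
Variables (K : comNzRingType) (P : nat -> lmodType K) (comp : comp_type P).

(** Bundling the arity turns each operad axiom into a plain equation, usable by rewriting although
    the two indices are not convertible. *)
Definition tcomp i (x y : {k : nat & P k}) : {k : nat & P k} :=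
  opTag (@comp (tag x) (tag y) i (tagged x) (tagged y)).

(** Equality proofs between natural numbers are unique, so the transport hidden in the equality of
    pairs is the identity. *)
Lemma opTag_inj k : injective (@opTag K P k).
Proof.
move=> x y eq_xy; rewrite -[y](projT2_eq eq_xy) /=.
by rewrite [projT1_eq _](eq_irrelevance _ (erefl k)).
Qed.

Lemma opTag_castP m n (e : m = n) (x : P m) : opTag (castP e x) = opTag x.
Proof. by case: n / e. Qed.

Lemma castP_lin m n (e : m = n) a (x y : P m) :
  castP e (a *: x + y) = a *: castP e x + castP e y.
Proof. by case: n / e. Qed.

Lemma op_gamma_from_rcons pos x ys y :
  op_gamma_from comp pos x (rcons ys y) =
  tcomp (pos + sumn [seq (tag z).+1 | z <- ys]) (op_gamma_from comp pos x ys) y.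
Proof.
elim: ys pos x => [|z ys IH] pos x /=; first by rewrite addn0.
by rewrite IH addnA.
Qed.

End TaggedComposition.

(** * The ns operad structure on polynomials *)

Section PolynomialOperad.
Variable K : comNzRingType.
Implicit Types (m n N c : nat).

Definition mblock N a l : mpolyR K N := \sum_(a <= t < a + l) mvar K N t.

(* the variables substituted into [p] in [p o_(c + 1) r], for [r] in [n + 1]
   variables *)
Definition insert_vars N c n (a : nat) : mpolyR K N :=
  if (a < c)%N then mvar K N a
  else if a == c then mblock N c n.+1 else mvar K N (a + n).

(** The target index [N] is free instead of [m + n], so that [opTag_Q] can replace it by an equal
    index. The position [c] counts from 0. *)
Definition Qinsert N m n c (p : mpolyR K m.+1) (r : mpolyR K n.+1) : Q K N :=
  meval p (insert_vars N.+1 c n) * meval r (fun b => mvar K N.+1 (c + b)).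

Lemma insert_before N c n a : (a < c)%N -> insert_vars N c n a = mvar K N a.
Proof. by rewrite /insert_vars => ->. Qed.

Lemma insert_at N c n : insert_vars N c n c = mblock N c n.+1.
Proof. by rewrite /insert_vars ltnn eqxx. Qed.

Lemma insert_after N c n a :
  (c < a)%N -> insert_vars N c n a = mvar K N (a + n).
Proof. by rewrite /insert_vars; case: ltngtP. Qed.

Lemma mblockE N a l : mblock N a l = \sum_(b < l) mvar K N (a + b).
Proof.
rewrite /mblock -{1}[a]add0n big_addn addKn big_mkord.
by apply: eq_bigr => b _; rewrite addnC.
Qed.

Lemma mblock_cat N a l l' :
  mblock N a l + mblock N (a + l) l' = mblock N a (l + l').
Proof. by rewrite /mblock addnA -big_cat_nat ?leq_addr. Qed.

Lemma QcompE m n i (p : Q K m) (r : Q K n) :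
  Qcomp i p r = Qinsert (m + n) i.-1 p r.
Proof.
rewrite /Qcomp /Qinsert; congr (_ * _); apply: eq_meval => a _.
by rewrite /insert_vars mblockE.
Qed.

Lemma meval_mblock N M a l (w : nat -> mpolyR K N) : (a + l <= M)%N ->
  meval (mblock M a l) w = \sum_(a <= t < a + l) w t.
Proof.
move=> leM; rewrite meval_sum; apply: eq_big_nat => t /andP[_ lt_t].
by rewrite meval_mvar // (leq_trans lt_t).
Qed.

Lemma sum_insert_before N c n a l : (a + l <= c)%N ->
  \sum_(a <= t < a + l) insert_vars N c n t = mblock N a l.
Proof.
move=> le_c; apply: eq_big_nat => t /andP[_ lt_t].
by rewrite insert_before // (leq_trans lt_t).
Qed.

Lemma sum_insert_after N c n a l : (c < a)%N ->
  \sum_(a <= t < a + l) insert_vars N c n t = mblock N (a + n) l.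
Proof.
move=> lt_c; rewrite /mblock big_addn addnAC addnK.
apply: eq_big_nat => t /andP[le_t _].
by rewrite insert_after // (leq_trans lt_c).
Qed.

(** The interval splits at [c]: the part before is unchanged, [c] opens into [n.+1] variables, and
    the part after shifts by [n], so the three pieces are contiguous. *)
Lemma sum_insert_in N c n a l : (a <= c < a + l)%N ->
  \sum_(a <= t < a + l) insert_vars N c n t = mblock N a (l + n).
Proof.
case/andP=> /subnKC def_c; move: (c - a)%N def_c => u <-{c}.
rewrite ltn_add2l => /subnKC; move: (l - _)%N => w <-{l}.
have le1 : (a <= a + u)%N := leq_addr _ _.
have le2 : (a + u < (a + u).+1 + w)%N by rewrite ltnS leq_addr.
have -> : (a + (u.+1 + w) = (a + u).+1 + w)%N by rewrite addnA addnS.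
rewrite (big_cat_nat le1 (ltnW le2)) (big_ltn le2) /=.
rewrite sum_insert_before // sum_insert_after //.
rewrite insert_at.
have -> : ((a + u).+1 + n = (a + u) + n.+1)%N by rewrite addSnnS.
by rewrite mblock_cat mblock_cat; congr mblock; lia.
Qed.

Lemma opTag_Q (F : forall k, Q K k) a b : a = b -> opTag (F a) = opTag (F b).
Proof. by move->. Qed.

(** Both sides expand to evaluations of [x], [y] and [z], so it remains to compare the substituted
    values. In the critical case, the block replacing input [i] of [x] contains the insertion point
    of [z] and grows by [n]. *)
Lemma Q_axiomI l m n (x : Q K l) (y : Q K m) (z : Q K n) i j :
  (1 <= i <= l.+1)%N -> (1 <= j <= m.+1)%N ->
  opTag (Qcomp (i - 1 + j)%N (Qcomp i x y) z) = opTag (Qcomp i x (Qcomp j y z)).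
Proof.
case: i => // i; case: j => // j; rewrite !ltnS /= => le_il le_jm.
rewrite subSS subn0 addnS !QcompE /=.
rewrite (opTag_Q (fun k => Qinsert k i x _) (addnA l m n)).
congr opTag; rewrite /Qinsert !mevalM !meval_comp -!mulrA.
congr (_ * (_ * _)); apply: eq_meval => a lt_a.
- case: (ltngtP a i) => [lt_ai|lt_ia|->].
  + have lt_aij := leq_trans lt_ai (leq_addr j i).
    by rewrite !insert_before // meval_mvar ?insert_before //; lia.
  + rewrite !(insert_after _ _ lt_ia) meval_mvar; last by lia.
    by rewrite insert_after ?addnA //; lia.
  + rewrite !insert_at meval_mblock; last by lia.
    by rewrite sum_insert_in ?addSn //; lia.
- rewrite meval_mvar; last by lia.
  case: (ltngtP a j) => [lt_aj|lt_ja|->].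
  + by rewrite !insert_before ?meval_mvar ?ltn_add2l //; lia.
  + by rewrite !insert_after ?meval_mvar ?ltn_add2l ?addnA //; lia.
  + rewrite !insert_at !mblockE meval_sum; apply: eq_bigr => b _.
    by rewrite meval_mvar ?addnA //; have := ltn_ord b; lia.
- by rewrite meval_mvar ?addnA //; lia.
Qed.

Lemma Q_axiomII l m n (x : Q K l) (y : Q K m) (z : Q K n) i k :
  (1 <= i)%N -> (i < k)%N -> (k <= l.+1)%N ->
  opTag (Qcomp (k + m)%N (Qcomp i x y) z) = opTag (Qcomp i (Qcomp k x z) y).
Proof.
case: i => // i _; case: k => // k; rewrite !ltnS => lt_ik le_kl.
rewrite addSn !QcompE /=.
rewrite -(opTag_Q (fun N => Qinsert N i _ y) (addnAC l m n)).
congr opTag; rewrite /Qinsert !mevalM !meval_comp -!mulrA.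
(* The factors of [y] and [z] appear in opposite orders on the two sides. *)
rewrite [X in _ * X]mulrC; congr (_ * (_ * _)); apply: eq_meval => a lt_a.
- case: (ltngtP a i) => [lt_ai|lt_ia|->].
  + by rewrite !insert_before ?meval_mvar ?insert_before //; lia.
  + rewrite insert_after // meval_mvar; last by lia.
    case: (ltngtP a k) => [lt_ak|lt_ka|->].
    * rewrite !insert_before ?ltn_add2r // meval_mvar ?insert_after //; lia.
    * rewrite !insert_after ?ltn_add2r // meval_mvar; last by lia.
      by rewrite insert_after; [congr mvar|]; lia.
    * by rewrite !insert_at meval_mblock ?sum_insert_after //; lia.
  + rewrite insert_at [in RHS]insert_before // meval_mblock; last by lia.
    by rewrite sum_insert_before ?meval_mvar ?insert_at //; lia.
- by rewrite meval_mvar ?insert_after; [congr mvar| |]; lia.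
- by rewrite meval_mvar ?insert_before //; lia.
Qed.

Lemma Q_id_comp n (x : Q K n) : opTag (Qcomp 1%N (Qid K) x) = opTag x.
Proof.
congr opTag; rewrite QcompE /Qinsert meval1 mul1r -[RHS]meval_id.
exact: eq_meval.
Qed.

(** The inserted block has a single term, so [x] keeps its variables and only gains a factor. *)
Lemma Qcomp_unary n i (x : Q K n) (y : Q K 0) : (0 < i)%N ->
  opTag (Qcomp i x y) =
  opTag ((x * @meval K n.+1 1 y (fun=> mvar K n.+1 i.-1) : mpolyR K n.+1) : Q K n).
Proof.
move=> i_gt0; rewrite QcompE (opTag_Q (fun k => @Qinsert k n 0 _ x y) (addn0 n)).
congr opTag; rewrite /Qinsert; congr (_ * _).
  rewrite -[RHS]meval_id; apply: eq_meval => a _.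
  rewrite /insert_vars mblockE big_ord1 !addn0.
  by case: ltngtP => // ->.
by apply: eq_meval => -[] // _; rewrite addn0.
Qed.

Lemma Qcomp_id n i (x : Q K n) : (0 < i)%N ->
  opTag (Qcomp i x (Qid K)) = opTag x.
Proof. by move/Qcomp_unary->; rewrite meval1 mulr1. Qed.

Lemma Qcomp_D n j (x : Q K n) :
  opTag (Qcomp j.+1 x (QD K)) =
  opTag ((x * mvar K n.+1 j : mpolyR K n.+1) : Q K n).
Proof. by rewrite Qcomp_unary // meval_mvar. Qed.

Lemma Qcomp_1_1 m n i :
  Qcomp i ((1 : mpolyR K m.+1) : Q K m) ((1 : mpolyR K n.+1) : Q K n) =
  (1 : mpolyR K (m + n).+1).
Proof. by rewrite QcompE /Qinsert !meval1 mulr1. Qed.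

Lemma Qcomp_linl m n i (a : K) (x y : Q K m) (z : Q K n) :
  Qcomp i (a *: x + y) z = a *: Qcomp i x z + Qcomp i y z.
Proof.
rewrite !QcompE /Qinsert mevalD mevalM meval_mconst mulrDl -mulrA.
by [].
Qed.

Lemma Qcomp_linr m n i (a : K) (x : Q K m) (y z : Q K n) :
  Qcomp i x (a *: y + z) = a *: Qcomp i x y + Qcomp i x z.
Proof.
rewrite !QcompE /Qinsert mevalD mevalM meval_mconst mulrDr mulrCA.
by [].
Qed.

Lemma Q_ns_operad : ns_operad (Qid K) (@Qcomp K).
Proof.
split.
- by split=> *; rewrite (Qcomp_linl, Qcomp_linr).
- exact: Q_id_comp.
- by move=> n i x /andP[i_gt0 _]; apply: Qcomp_id.
- exact: Q_axiomI.
- exact: Q_axiomII.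
Qed.

(** Associativity reads 1 = 1. In the Leibniz rule, substituting x_1 + x_2 into x_1 gives the sum of
    the two variables contributed by D at either input of mu. *)
Lemma Q_asder_rel : asder_rel (@Qcomp K) (QD K) (Qmu K).
Proof.
split; first by rewrite !Qcomp_1_1.
have muD j : Qcomp j.+1 (Qmu K) (QD K) = mvar K 2 j :> mpolyR K 2.
  apply: (@opTag_inj K (Q K) 1).
  by rewrite -[mvar K 2 j]mul1r; exact: (@Qcomp_D 1 j (Qmu K)).
rewrite !muD QcompE /Qinsert meval1 mulr1 meval_mvar //.
by rewrite /insert_vars /= /mblock big_nat_recr //= big_nat1.
Qed.

End PolynomialOperad.

(** * Operad axioms and the Leibniz rule for bundled operations *)

Section TaggedAxioms.
Variables (K : comNzRingType) (P : nat -> lmodType K) (id : P 0%N).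
Variables (comp : comp_type P) (opP : ns_operad id comp).
Implicit Types x y z : {k : nat & P k}.

Lemma tcomp_id_l x : tcomp comp 1 (opTag id) x = x.
Proof. by case: opP x => _ idl _ _ _ [n x]; apply: idl. Qed.

Lemma tcomp_id_r x i : (1 <= i <= (tag x).+1)%N -> tcomp comp i x (opTag id) = x.
Proof. by case: opP x => _ _ idr _ _ [n x]; apply: idr. Qed.

Lemma tcomp_assoc x y z i j : (1 <= i <= (tag x).+1)%N ->
  (1 <= j <= (tag y).+1)%N ->
  tcomp comp (i - 1 + j) (tcomp comp i x y) z =
  tcomp comp i x (tcomp comp j y z).
Proof.
by case: opP x y z => _ _ _ assoc _ [l x] [m y] [n z]; apply: assoc.
Qed.

Lemma tcomp_assoc1 x y z j : (1 <= j <= (tag y).+1)%N ->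
  tcomp comp j (tcomp comp 1 x y) z = tcomp comp 1 x (tcomp comp j y z).
Proof. by move=> le_j; rewrite -tcomp_assoc // subnn. Qed.

Lemma tcomp_par x y z i k : (1 <= i)%N -> (i < k)%N -> (k <= (tag x).+1)%N ->
  tcomp comp (k + tag y) (tcomp comp i x y) z =
  tcomp comp i (tcomp comp k x z) y.
Proof. by case: opP x y z => _ _ _ _ par [l x] [m y] [n z]; apply: par. Qed.

(** Sequential associativity transports the Leibniz rule to input [j] of [x]. The elements [u] and
    [w] represent the two compositions at a common index where they can be added. *)
Lemma asder_rel_comp (d : P 0%N) (mu : P 1%N) k (x : P k) (u w : P (k + 1)%N) j :
  asder_rel comp d mu -> (1 <= j <= k.+1)%N ->
  let y := tcomp comp j (opTag x) (opTag mu) in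
  opTag u = tcomp comp j y (opTag d) ->
  opTag w = tcomp comp j.+1 y (opTag d) ->
  tcomp comp j (tcomp comp j (opTag x) (opTag d)) (opTag mu) = opTag (u + w).
Proof.
case: opP => -[_ linr] _ _ _ _ [_ leib] le_j y.
have j_gt0 : (0 < j)%N by case/andP: le_j.
have j1 : (j - 1 + 1)%N = j by rewrite subnK.
have j2 : (j - 1 + 2)%N = j.+1 by lia.
have := @tcomp_assoc (opTag x) (opTag mu) (opTag d) j 1 le_j isT.
have := @tcomp_assoc (opTag x) (opTag mu) (opTag d) j 2 le_j isT.
have := @tcomp_assoc (opTag x) (opTag d) (opTag mu) j 1 le_j isT.
rewrite j1 j2 /y => -> -> -> /opTag_inj -> /opTag_inj ->.
rewrite /tcomp /= leib; congr opTag.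
have := linr k 1%N j le_j 1 x (comp 1%N mu d) (comp 2%N mu d).
by rewrite !scale1r.
Qed.

End TaggedAxioms.

(** * The universal property of AsDer for polynomials *)

Section Universality.
Variable K : comNzRingType.
Variables (O : nat -> lmodType K) (idO : O 0%N) (compO : comp_type O).
Hypothesis opO : ns_operad idO compO.

Local Notation tcQ := (tcomp (@Qcomp K)).
Local Notation tcO := (tcomp compO).
Local Notation opQ := (Q_ns_operad K).
Local Notation tD := (opTag (QD K)).
Local Notation tmu := (opTag (Qmu K)).

Definition ttag (f : forall k, Q K k -> O k) (x : {k : nat & Q K k}) :
  {k : nat & O k} := opTag (f (tag x) (tagged x)).

Lemma ttag_comp f x y i : operad_morphism (Qid K) (@Qcomp K) idO compO f ->
  (1 <= i <= (tag x).+1)%N ->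
  ttag f (tcQ i x y) = tcO i (ttag f x) (ttag f y).
Proof. by case=> _ _ fcomp le_i; rewrite /ttag /tcomp /= fcomp. Qed.

Definition Qone k : Q K k := (1 : mpolyR K k.+1).
Definition Qmul_var k j (p : Q K k) : Q K k := (p : mpolyR K k.+1) * mvar K k.+1 j.

Lemma Q_ind k (P : Q K k -> Prop) :
  P (Qone k) -> (forall c p q, P p -> P q -> P (c *: p + q)) ->
  (forall j p, (j < k.+1)%N -> P p -> P (Qmul_var j p)) ->
  forall p, P p.
Proof. exact: mpoly_ind. Qed.

Lemma Qmul_varE k j (p : Q K k) :
  opTag (Qmul_var j p) = tcQ j.+1 (opTag p) tD.
Proof. by rewrite /tcomp Qcomp_D. Qed.

Lemma Qone_mu k j : tcQ j (opTag (Qone k)) tmu = opTag (Qone k.+1).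
Proof.
rewrite /tcomp /= Qcomp_1_1.
exact: (opTag_Q Qone (addn1 k)).
Qed.

(** Agreement on the constants 1 follows by composing with mu one arity at a time; a variable factor
    is then a right composition with D. *)
Lemma Q_morphism_ext (f g : forall k, Q K k -> O k) :
  operad_morphism (Qid K) (@Qcomp K) idO compO f ->
  operad_morphism (Qid K) (@Qcomp K) idO compO g ->
  f 0%N (QD K) = g 0%N (QD K) -> f 1%N (Qmu K) = g 1%N (Qmu K) ->
  forall k x, f k x = g k x.
Proof.
move=> morf morg eqD eqmu k p; elim/Q_ind: p => [|c p q IHp IHq|a p lt_a IHp].
- apply: opTag_inj; elim: k => [|k IH].
    by case: morf morg => _ f1 _ [_ g1 _]; rewrite f1 g1.
  rewrite -!/(ttag _ (opTag (_ : Q K k.+1))) -(Qone_mu _ 1) !ttag_comp //.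
  by rewrite /ttag /= IH eqmu.
- by case: morf morg => flin _ _ [glin _ _]; rewrite flin glin IHp IHq.
- apply: opTag_inj; rewrite -!/(ttag _ (opTag (_ : Q K k))) Qmul_varE !ttag_comp //.
  by rewrite /ttag /= IHp eqD.
Qed.

Variables (d : O 0%N) (mu : O 1%N).
Hypothesis rel : asder_rel compO d mu.

Local Notation td := (opTag d).
Local Notation tm := (opTag mu).
Local Notation mun := (op_mun idO compO mu).

(** An input inside the nested product is handled by induction. At the last input, the parallel
    axiom brings both copies of [mu] together, and associativity trades [mu] o_2 [mu] for [mu] o_1
    [mu]. *)
Lemma mun_comp k j : (1 <= j <= k.+1)%N ->
  tcO j (opTag (mun k)) tm = opTag (mun k.+1).
Proof.
have munS n : opTag (mun n.+1) = tcO 1 tm (opTag (mun n)) by [].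
elim: k j => [|k IH] j /andP[j_gt0].
  case: j j_gt0 => [|[|]] // _ _.
  by rewrite (tcomp_id_l opO) munS (tcomp_id_r opO).
rewrite leq_eqVlt => /orP[/eqP->|lt_j].
  rewrite munS -[k.+2]/(2 + tag (opTag (mun k)))%N (tcomp_par opO) //.
  have -> : tcO 2 tm tm = tcO 1 tm tm by rewrite /tcomp /= rel.1.
  by rewrite (tcomp_assoc1 opO).
by rewrite munS (tcomp_assoc1 opO) ?j_gt0 // IH ?j_gt0.
Qed.

(** The cast removes the index [k + 0], giving an endomorphism of [O k] that can be iterated; [j]
    counts from 0. *)
Definition act_d k j (o : O k) : O k := castP (addn0 k) (compO j.+1 o d).

Lemma opTag_act_d k j (o : O k) : opTag (act_d j o) = tcO j.+1 (opTag o) td.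
Proof. exact: opTag_castP. Qed.

Lemma act_d_lin k : lin_below (@act_d k) k.+1.
Proof.
move=> j lt_j a x y; rewrite /act_d; case: opO => -[linl _] _ _ _ _.
by rewrite linl // castP_lin.
Qed.

(** This is the parallel axiom at two distinct inputs; as [d] is unary, neither insertion shifts the
    other. *)
Lemma act_dC k i j (o : O k) : (i < k.+1)%N -> (j < k.+1)%N ->
  act_d i (act_d j o) = act_d j (act_d i o).
Proof.
wlog lt_ij : i j / (i < j)%N.
  move=> th lti ltj; case: (ltngtP i j) => [lt_ij|lt_ji|->] //.
    exact: th.
  exact/esym/th.
move=> lt_ik lt_jk; apply: opTag_inj; rewrite !opTag_act_d.
rewrite -(tcomp_par opO) //; congr (tcO _ _ _).
by rewrite /= addn0.
Qed.

Definition asder_map k (p : Q K k) : O k := mact (@act_d k) (mun k) p.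

Lemma asder_map1 k : asder_map (Qone k) = mun k.
Proof. exact: mact1. Qed.

Lemma asder_map_lin k a (x y : Q K k) :
  asder_map (a *: x + y) = a *: asder_map x + asder_map y.
Proof. exact: mact_linear (@act_d_lin k). Qed.

Lemma asder_map_D x j : (1 <= j <= (tag x).+1)%N ->
  ttag asder_map (tcQ j x tD) = tcO j (ttag asder_map x) td.
Proof.
case: j x => // j [k p] lt_j; rewrite -Qmul_varE /ttag -opTag_act_d.
congr opTag; apply: mact_mvar => //; first exact: act_d_lin.
by move=> *; apply: act_dC.
Qed.

Lemma asder_map_mu x j : (1 <= j <= (tag x).+1)%N ->
  ttag asder_map (tcQ j x tmu) = tcO j (ttag asder_map x) tm.
Proof.
case: x => k p /= le_j; congr opTag.
elim/Q_ind: p => [|c p q IHp IHq|a p lt_a IHp].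
- apply: opTag_inj.
  rewrite -[LHS]/(ttag asder_map (tcQ j (opTag (Qone k)) tmu)).
  rewrite Qone_mu -[RHS]/(tcO j (opTag (asder_map (Qone k))) tm).
  by rewrite asder_map1 mun_comp //; congr opTag; apply: asder_map1.
- rewrite /= Qcomp_linl !asder_map_lin.
  by case: opO => -[linl _] _ _ _ _; rewrite linl // IHp IHq.
apply: opTag_inj.
rewrite -[LHS]/(ttag asder_map (tcQ j (opTag (_ : Q K k)) tmu)).
rewrite -[RHS]/(tcO j (ttag asder_map (opTag (_ : Q K k))) tm).
have {}IHp : ttag asder_map (tcQ j (opTag (p : Q K k)) tmu) =
  tcO j (ttag asder_map (opTag (p : Q K k))) tm by congr opTag.
rewrite Qmul_varE asder_map_D // ; set x := opTag _ in IHp *.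
(* At distinct inputs the parallel axiom exchanges D and mu; D moves one place to the right exactly
   when mu is inserted before it. *)
have [lt_aj|lt_ja|eq_aj] := ltngtP a.+1 j.
- have le_jx : (j <= (tag x).+1)%N by case/andP: le_j.
  have := tcomp_par opQ tD tmu (ltn0Sn a) lt_aj le_jx.
  have := tcomp_par (x := ttag asder_map x) opO td tm (ltn0Sn a) lt_aj le_jx.
  rewrite !addn0 => -> ->; rewrite asder_map_D ?IHp //=.
  by rewrite (leq_trans lt_a) // ltnS leq_addr.
- have j_gt0 : (0 < j)%N by case/andP: le_j.
  have := tcomp_par opQ tmu tD j_gt0 lt_ja (lt_a : (a < (tag x).+1)%N).
  have := tcomp_par (x := ttag asder_map x) opO tm td j_gt0 lt_ja
    (lt_a : (a < (tag x).+1)%N).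
  move=> <- <-; rewrite asder_map_D ?IHp //=.
  by rewrite !addn1 ltnS.
(* At the same input the Leibniz rule splits both sides into two terms, each a right composition
   with D, to which [asder_map_D] and the induction hypothesis apply. *)
rewrite {}eq_aj in lt_a *.
have [u uE] : exists u : Q K (k + 1)%N, opTag u = tcQ j (tcQ j x tmu) tD.
  by exists (castP (addn0 _) (tagged (tcQ j (tcQ j x tmu) tD))); rewrite opTag_castP.
have [w wE] : exists u : Q K (k + 1)%N, opTag u = tcQ j.+1 (tcQ j x tmu) tD.
  by exists (castP (addn0 _) (tagged (tcQ j.+1 (tcQ j x tmu) tD))); rewrite opTag_castP.
rewrite (asder_rel_comp opQ (Q_asder_rel K) le_j uE wE).
have le_j1 : (j < (tag (tcQ j x tmu)).+1)%N by case/andP: le_j; rewrite /= addn1.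
have j_gt0 : (0 < j)%N by case/andP: le_j.
have Fu : opTag (asder_map u) = tcO j (tcO j (ttag asder_map x) tm) td.
  by rewrite -[LHS]/(ttag asder_map (opTag u)) uE asder_map_D ?IHp // j_gt0 ltnW.
have Fw : opTag (asder_map w) = tcO j.+1 (tcO j (ttag asder_map x) tm) td.
  by rewrite -[LHS]/(ttag asder_map (opTag w)) wE asder_map_D ?IHp.
rewrite (asder_rel_comp opO rel le_j Fu Fw) /ttag /=; congr opTag.
by have := asder_map_lin 1 u w; rewrite !scale1r.
Qed.

Lemma asder_map_comp m n i (x : Q K m) (y : Q K n) : (1 <= i <= m.+1)%N ->
  asder_map (Qcomp i x y) = compO i (asder_map x) (asder_map y).
Proof.
move=> le_i.
(* Sequential associativity passes compatibility from [z] to its right composition with [tz'], which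
   will be either generator. *)
have step (z : {k : nat & Q K k}) tz' tz'' j :
  (forall v : {k : nat & Q K k}, forall l, (1 <= l <= (tag v).+1)%N ->
     ttag asder_map (tcQ l v tz') = tcO l (ttag asder_map v) tz'') ->
  (1 <= j <= (tag z).+1)%N ->
  ttag asder_map (tcQ i (opTag x) z) = tcO i (opTag (asder_map x)) (ttag asder_map z) ->
  ttag asder_map (tcQ i (opTag x) (tcQ j z tz')) =
  tcO i (opTag (asder_map x)) (ttag asder_map (tcQ j z tz')).
  move=> gen le_j IH; rewrite -(tcomp_assoc opQ) // !gen //= ?IH.
    by rewrite (tcomp_assoc opO).
  by case: z {IH} le_j => nz z /= le_j; move: le_i le_j; lia.
apply: opTag_inj.
rewrite -[LHS]/(ttag asder_map (tcQ i (opTag x) (opTag y))).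
rewrite -[RHS]/(tcO i (opTag (asder_map x)) (ttag asder_map (opTag y))).
elim/Q_ind: y => [|c p q IHp IHq|a p lt_a IHp].
- elim: n => [|n IH].
    rewrite (tcomp_id_r opQ) //.
    have -> : ttag asder_map (opTag (Qid K)) = opTag idO by congr opTag; apply: asder_map1.
    by rewrite (tcomp_id_r opO).
  by rewrite -(Qone_mu _ 1); apply: (step _ _ _ _ asder_map_mu).
- congr opTag; rewrite /= asder_map_lin Qcomp_linr asder_map_lin.
  case: opO => -[_ linr] _ _ _ _; rewrite linr //.
  by rewrite (opTag_inj IHp) (opTag_inj IHq).
- by rewrite Qmul_varE; apply: (step _ _ _ _ asder_map_D).
Qed.

Lemma asder_map_morphism : operad_morphism (Qid K) (@Qcomp K) idO compO asder_map.
Proof.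
by split=> *; [apply: asder_map_lin | apply: asder_map1 | apply: asder_map_comp].
Qed.

(** Writing D as id o_1 D reduces the claim to right composition with D. *)
Lemma asder_mapD : asder_map (QD K) = d.
Proof.
apply: opTag_inj; rewrite -[LHS]/(ttag asder_map (opTag (QD K))).
rewrite -(tcomp_id_l opQ tD) asder_map_D // -[RHS](tcomp_id_l opO).
by congr tcomp; congr opTag; apply: asder_map1.
Qed.

Lemma asder_map_Qmu : asder_map (Qmu K) = mu.
Proof.
rewrite -[LHS]/(asder_map (Qone 1)) asder_map1.
by apply: opTag_inj; rewrite -[LHS]/(tcO 1 tm (opTag idO)) (tcomp_id_r opO).
Qed.


End Universality.

Lemma Q_presents_AsDer (K : comNzRingType) :
  presents_AsDer (Qid K) (@Qcomp K) (QD K) (Qmu K).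
Proof.
split=> [|O idO compO opO d mu rel]; first exact: Q_asder_rel.
have morf := asder_map_morphism opO rel.
exists (@asder_map K O idO compO d mu); split.
- exact: morf.
- exact: asder_mapD.
- exact: asder_map_Qmu.
move=> g morg gD gmu; apply: (Q_morphism_ext morg morf).
  by rewrite gD asder_mapD.
by rewrite gmu asder_map_Qmu.
Qed.

(** * Products of powers of D as monomials *)

Section Monomials.
Variable K : comNzRingType.

Lemma Q_mun k : op_mun (Qid K) (@Qcomp K) (Qmu K) k = Qone K k.
Proof. by elim: k => //= k ->; exact: (Qcomp_1_1 K 1 k 1). Qed.

Lemma Q_Dpow j :
  op_Dpow (Qid K) (@Qcomp K) (QD K) j = mvar K 1 0 ^+ j :> mpolyR K 1.
Proof.
elim: j => [|j IH]; first by rewrite expr0.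
rewrite [LHS]/= exprS.
have := @Qcomp_unary K 0 1 (QD K) (op_Dpow (Qid K) (@Qcomp K) (QD K) j) isT.
by move/opTag_inj->; rewrite IH mevalX meval_mvar.
Qed.

(** The partial filling up to [r] supports the induction: each further unary insertion multiplies by
    a power of the next variable. *)
Lemma Q_monomial k (j : nat -> nat) r : (r <= k.+1)%N ->
  op_fill_unary (@Qcomp K) (op_mun (Qid K) (@Qcomp K) (Qmu K) k)
    (fun s => op_Dpow (Qid K) (@Qcomp K) (QD K) (j s)) r =
  \prod_(s < r) mvar K k.+1 s ^+ j s :> mpolyR K k.+1.
Proof.
elim: r => [|r IH] le_r; first by rewrite big_ord0 Q_mun.
rewrite big_ord_recr -IH 1?ltnW //=.
apply: (@opTag_inj K (Q K) k); rewrite opTag_castP Qcomp_unary //.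
by rewrite Q_Dpow mevalX meval_mvar.
Qed.

End Monomials.

(** * Closed formula for the full composition *)

Section FullComposition.
Variable K : comNzRingType.
Local Notation y0 := (opTag (0 : Q K 0%N)).
Implicit Types ys : seq {n : nat & Q K n}.

Definition block_size ys r := (tag (nth y0 ys r)).+1.
Definition block_start ys r := (\sum_(s < r) block_size ys s)%N.
(** The total growth in arity: each operand replaces one input by [(tag y).+1] inputs. *)
Definition excess ys := (\sum_(s < size ys) tag (nth y0 ys s))%N.

(* the polynomial obtained by plugging [ys] into the first [size ys] inputs
   of [p], leaving the other inputs untouched *)
Definition gamma_prefix N k (p : Q K k) ys : Q K N :=
  @meval K N.+1 k.+1 p (fun a =>
    if (a < size ys)%N then mblock K N.+1 (block_start ys a) (block_size ys a)
    else mvar K N.+1 (a + excess ys)) *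
  \prod_(r < size ys)
     @meval K N.+1 (tag (nth y0 ys r)).+1 (tagged (nth y0 ys r))
       (fun b => mvar K N.+1 (block_start ys r + b)).

Lemma block_startS ys r : block_start ys r.+1 = (block_start ys r + block_size ys r)%N.
Proof. exact: big_ord_recr. Qed.

Lemma leq_block_start ys r s : (r <= s)%N -> (block_start ys r <= block_start ys s)%N.
Proof.
move/subnKC <-; elim: (s - r)%N => [|t IH]; first by rewrite addn0.
by rewrite addnS block_startS (leq_trans IH) ?leq_addr.
Qed.

Lemma block_start_size ys : block_start ys (size ys) = (size ys + excess ys)%N.
Proof.
rewrite /block_start /excess -[X in (X + _)%N]card_ord -sum1_card -big_split.
by apply: eq_bigr => s _; rewrite /= add1n.
Qed.

Lemma sumn_arities ys : sumn [seq (tag z).+1 | z <- ys] = block_start ys (size ys).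
Proof. by rewrite sumnE big_map (big_nth y0) big_mkord. Qed.

Lemma block_size_rcons ys y r : (r < size ys)%N ->
  block_size (rcons ys y) r = block_size ys r.
Proof. by rewrite /block_size nth_rcons => ->. Qed.

Lemma block_start_rcons ys y r : (r <= size ys)%N ->
  block_start (rcons ys y) r = block_start ys r.
Proof.
move=> le_r; apply: eq_bigr => s _.
by rewrite block_size_rcons // (leq_trans (ltn_ord s)).
Qed.

Lemma excess_rcons ys y : excess (rcons ys y) = (excess ys + tag y)%N.
Proof.
rewrite /excess size_rcons big_ord_recr /= nth_rcons ltnn eqxx; congr (_ + _)%N.
by apply: eq_bigr => s _; rewrite nth_rcons ltn_ord.
Qed.

(** Induction appends operands at the end. A new [y] goes in just after the existing blocks: it
    leaves them fixed, opens the first untouched variable into a block and shifts the later ones by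
    [tag y]. *)
Lemma op_gamma_prefix k (p : Q K k) ys : (size ys <= k.+1)%N ->
  op_gamma (@Qcomp K) (opTag p) ys = opTag (gamma_prefix (k + excess ys) p ys).
Proof.
elim/last_ind: ys => [|ys y IH].
  rewrite /excess big_ord0 (opTag_Q (fun N => gamma_prefix N p [::]) (addn0 k)) => _.
  congr opTag; rewrite /gamma_prefix big_ord0 mulr1 -[LHS]meval_id.
  by apply: eq_meval => a _; rewrite /excess big_ord0 addn0.
rewrite size_rcons => lt_ys.
rewrite /op_gamma op_gamma_from_rcons -/(op_gamma _ _ _) IH ?(ltnW lt_ys) //.
rewrite sumn_arities add1n /tcomp /= QcompE /=.
rewrite (opTag_Q (fun N => @Qinsert K N _ _ _ _ _) (esym (addnA k _ _))) -excess_rcons.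
congr opTag; rewrite /Qinsert /gamma_prefix mevalM meval_comp meval_prod.
(* Variables of earlier blocks lie strictly before the insertion point. *)
have lt_off r b : (r < size ys)%N -> (b < block_size ys r)%N ->
  (block_start ys r + b < block_start ys (size ys))%N.
  move=> lt_r lt_b; rewrite (leq_trans _ (leq_block_start _ lt_r)) //.
  by rewrite block_startS ltn_add2l.
have start_size := block_start_size ys.
rewrite size_rcons big_ord_recr -!mulrA; congr (_ * (_ * _)).
- apply: eq_meval => a lt_a; rewrite ltnS excess_rcons.
  case: (ltngtP a (size ys)) => [lt_ay|lt_ya|->].
  + rewrite block_start_rcons ?(ltnW lt_ay) // block_size_rcons //.
    have le_blk : (block_start ys a + block_size ys a <= block_start ys (size ys))%N.
      by rewrite -block_startS leq_block_start.
    by rewrite meval_mblock ?sum_insert_before //; lia.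
  + rewrite meval_mvar ?ltnS ?leq_add2r // insert_after ?addnA //.
    by rewrite start_size ltn_add2r.
  + rewrite meval_mvar ?ltnS ?leq_add2r // -start_size insert_at block_start_rcons //.
    by rewrite /block_size nth_rcons ltnn eqxx.
- apply: eq_bigr => r _; rewrite meval_comp nth_rcons [nat_of_ord (widen_ord _ _)]/= (ltn_ord r).
  rewrite block_start_rcons ?(ltnW (ltn_ord r)) //.
  apply: eq_meval => b lt_b; have lt_rb := lt_off _ _ (ltn_ord r) lt_b.
  by rewrite meval_mvar ?insert_before //; lia.
by rewrite block_start_rcons // nth_rcons ltnn eqxx.
Qed.

Lemma Q_gamma k (p : Q K k) ys : size ys = k.+1 ->
  op_gamma (@Qcomp K) (opTag p) ys = opTag (Qgamma_formula p ys).
Proof.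
move=> sz; rewrite op_gamma_prefix ?sz //.
(* By [block_start_size] the arities add up to [k.+1 + excess ys], hence the predecessor. *)
have -> : (k + excess ys)%N =
    (\sum_(r < k.+1) (tag (nth y0 ys r)).+1).-1.
  by have := block_start_size ys; rewrite sz /block_start /block_size => ->.
congr opTag; rewrite /gamma_prefix /Qgamma_formula sz; congr (_ * _).
by apply: eq_meval => a lt_a; rewrite lt_a mblockE.
Qed.

End FullComposition.

Theorem theorem2p2 (K : comNzRingType) :
  (* Q with partial compositions Qcomp and unit 1 in K[x_1] is a ns operad *)
  ns_operad (Qid K) (@Qcomp K)
  (* AsDer ≅ Q via id |-> 1, D |-> x_1, mu |-> 1 in K[x_1,x_2] *)
  /\ presents_AsDer (Qid K) (@Qcomp K) (QD K) (Qmu K)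
  (* closed formula for the full composition gamma(P; Q_1, ..., Q_k) *)
  /\ (forall (k : nat) (p : Q K k) (ys : seq {n : nat & Q K n}),
        size ys = k.+1 ->
        op_gamma (@Qcomp K) (opTag p) ys = opTag (Qgamma_formula p ys))
  (* mu_n o (D^{j_1}, ..., D^{j_n}) corresponds to x_1^{j_1} ... x_n^{j_n} *)
  /\ (forall (k : nat) (j : nat -> nat),
        op_fill_unary (@Qcomp K) (op_mun (Qid K) (@Qcomp K) (Qmu K) k)
          (fun s => op_Dpow (Qid K) (@Qcomp K) (QD K) (j s)) k.+1
        = ((\prod_(s < k.+1) mvar K k.+1 s ^+ j s : mpoly K k.+1) : Q K k)).
Proof.
split; first exact: Q_ns_operad.
split; first exact: Q_presents_AsDer.
split=> [k p ys|k j]; first exact: Q_gamma.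
exact: Q_monomial.
Qed.
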